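(* Let $I\subset K[x_1,\ldots,x_n]$ be a weakly polymatroidal ideal which is sortable. Then $I$ satisfies the $\ell$-exchange property with respect to the sorting order.
   Context: $K$ is a field, the variables are ordered $x_1>\cdots>x_n$, and $I$ is a monomial ideal generated in one degree $d$ with minimal monomial generating set $G(I)=\{u_1,\ldots,u_m\}$. Weakly polymatroidal: for any two monomials $u=x_1^{a_1}\cdots x_n^{a_n}$, $v=x_1^{b_1}\cdots x_n^{b_n}$ in $G(I)$ for which there is $t$ with $a_1=b_1,\ldots,a_{t-1}=b_{t-1}$ and $a_t>b_t$, there exists $\ell>t$ such that $x_\ell$ divides $v$ and $x_t(v/x_\ell)\in I$. Sortable: for $u,v\in G(I)$ write $uv=x_{i_1}x_{i_2}\cdots x_{i_{2d}}$ with $i_1\le\cdots\le i_{2d}$ and set $\operatorname{sort}(u,v)=(x_{i_1}x_{i_3}\cdots x_{i_{2d-1}},\,x_{i_2}x_{i_4}\cdots x_{i_{2d}})$. $I$ is sortable if $\operatorname{sort}(u,v)\in G(I)\times G(I)$ for all $u,v\in G(I)$. A pair $(u,v)$ is sorted if $\operatorname{sort}(u,v)=(u,v)$, and unsorted otherwise. Let $R=K[y_1,\ldots,y_m]$, $\varphi:R\to K[u_1,\ldots,u_m]$ with $\varphi(y_i)=u_i$, and $L=\operatorname{Ker}\varphi$. For $u=u_i$ write $y_u=y_i$. By a theorem of Sturmfels, when $G(I)$ is sortable there is a monomial order on $R$ (the sorting order) for which the binomials $y_uy_v-y_{u'}y_{v'}$, with $(u,v)$ unsorted and $(u',v')=\operatorname{sort}(u,v)$,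 form a Gröbner basis of $L$ with leading monomials $y_uy_v$. $\ell$-exchange property with respect to a monomial order $\prec$ on $R$: a monomial of $R$ is a standard monomial of $L$ if it does not belong to the initial ideal of $L$ with respect to $\prec$. $I$ satisfies the $\ell$-exchange property if for any two standard monomials $\mathbf y^a,\mathbf y^b$ of $L$ of the same degree satisfying (i) $\deg_{x_t}\varphi(\mathbf y^a)=\deg_{x_t}\varphi(\mathbf y^b)$ for $t=1,\ldots,q-1$ with $q\le n-1$, and (ii) $\deg_{x_q}\varphi(\mathbf y^a)<\deg_{x_q}\varphi(\mathbf y^b)$, there exist a factor $u_\delta$ of $\varphi(\mathbf y^a)$ (i.e. $y_\delta$ divides $\mathbf y^a$) and $q<j\le n$ such that $x_j$ divides $u_\delta$ and $x_qu_\delta/x_j\in I$. *)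

(* Defs.v *)
From HB Require Import structures.
From mathcomp Require Import all_boot all_order all_algebra.
From mathcomp Require Import mpoly.

Set Implicit Arguments.
Unset Strict Implicit.
Unset Printing Implicit Defensive.

Import GRing.Theory.

Local Open Scope ring_scope.

(* Indices are 0-based: x_1, ..., x_n are the variables 'X_i, i : 'I_n, and    *)
(* x_1 > ... > x_n means that smaller indices come first.                      *)
(* Ideals are Prop-valued predicates on a polynomial ring.                     *)

Definition ideal_gen (A : comNzRingType) (S : A -> Prop) (f : A) : Prop :=
  exists s : seq (A * A),
    (forall c, c \in s -> S c.2) /\ f = \sum_(c <- s) c.1 * c.2.

Definition monomials (K : fieldType) (n : nat) (M : 'X_{1..n} -> Prop)
    (p : {mpoly K[n]}) : Prop :=
  exists2 w, M w & p = 'X_[w].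

Section MonomialIdeal.

Variables (K : fieldType) (n m : nat).
Implicit Types (I : {mpoly K[n]} -> Prop) (G : m.-tuple 'X_{1..n}).

(* G lists, without repetition, the minimal monomial generating set G(I);      *)
(* in particular I is a monomial ideal.                                        *)
Definition minimal_monomial_generators I G : Prop :=
  [/\ uniq G,
      forall f, I f <-> ideal_gen (monomials (fun w => w \in G)) f
    & forall w, w \in G ->
        ~ (forall f,
             I f <-> ideal_gen (monomials (fun w' => w' \in G /\ w' <> w)) f)].

Definition generated_in_degree G (d : nat) : Prop :=
  forall w, w \in G -> mdeg w = d.

Definition weakly_polymatroidal I G : Prop :=
  forall u v, u \in G -> v \in G ->
  forall t : 'I_n, (forall s : 'I_n, (s < t)%N -> u s = v s) -> (v t < u t)%N ->
  exists l : 'I_n,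
    [/\ (t < l)%N, (0 < v l)%N & I 'X_[(U_(t) + (v - U_(l)))%MM]].

End MonomialIdeal.

Section Sorting.

Variable n : nat.
Implicit Types (u v w : 'X_{1..n}) (s : seq 'I_n).

(* The weakly increasing sequence i_1 <= i_2 <= ... of the indices of the      *)
(* variables of w = x_{i_1} x_{i_2} ..., repeated with multiplicity.           *)
Definition mnm_indices w : seq 'I_n :=
  flatten [seq nseq (w i) i | i <- enum 'I_n].

(* Positions are counted from 0, so the even ones hold i_1, i_3, i_5, ...      *)
Definition even_positions s : seq 'I_n :=
  mask (mkseq (fun k => ~~ odd k) (size s)) s.

Definition odd_positions s : seq 'I_n := mask (mkseq odd (size s)) s.

Definition mnm_of_indices s : 'X_{1..n} := (\sum_(i <- s) U_(i))%MM.

Definition sort_pair (p : 'X_{1..n} * 'X_{1..n}) : 'X_{1..n} * 'X_{1..n} :=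
  let s := mnm_indices (p.1 + p.2)%MM in
  (mnm_of_indices (even_positions s), mnm_of_indices (odd_positions s)).

Definition sorted_pair (p : 'X_{1..n} * 'X_{1..n}) : Prop := sort_pair p = p.

Definition sortable (m : nat) (G : m.-tuple 'X_{1..n}) : Prop :=
  forall u v, u \in G -> v \in G ->
    (sort_pair (u, v)).1 \in G /\ (sort_pair (u, v)).2 \in G.

End Sorting.

Section Groebner.

Variables (K : fieldType) (m : nat) (ord : rel 'X_{1..m}).
Implicit Types (J B : {mpoly K[m]} -> Prop).

(* ord a b is the non-strict comparison "a is at most b".                      *)
Definition monomial_order : Prop :=
  [/\ reflexive ord, antisymmetric ord, transitive ord & total ord]
  /\ [/\ forall a, ord 0%MM a
       & forall a b c, ord a b -> ord (a + c)%MM (b + c)%MM].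

Definition is_leading_monomial (f : {mpoly K[m]}) (w : 'X_{1..m}) : Prop :=
  w \in msupp f /\ forall w', w' \in msupp f -> ord w' w.

(* The zero polynomial has no leading monomial, so it contributes nothing.     *)
Definition initial_ideal J : {mpoly K[m]} -> Prop :=
  ideal_gen (monomials (fun w => exists2 f, J f & is_leading_monomial f w)).

(* When B is contained in J, initial_ideal B is the ideal generated by the     *)
(* leading monomials of the elements of B alone.                               *)
Definition groebner_basis J B : Prop :=
  (forall f, B f -> J f) /\ (forall f, initial_ideal J f <-> initial_ideal B f).

Definition standard_monomial J (a : 'X_{1..m}) : Prop :=
  ~ initial_ideal J 'X_[a].

End Groebner.

Section ToricIdeal.

Variables (K : fieldType) (n m : nat) (G : m.-tuple 'X_{1..n}).

(* The codomain is all of K[x_1, ..., x_n] instead of the subalgebra generated *)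
(* by the monomials of G; the kernel is the same.                              *)
Definition toric_map (f : {mpoly K[m]}) : {mpoly K[n]} :=
  f \mPo [tuple 'X_[tnth G i] | i < m].

Definition toric_ideal (f : {mpoly K[m]}) : Prop := toric_map f = 0.

Definition sorting_rule (i j k l : 'I_m) : Prop :=
  let p := (tnth G i, tnth G j) in
  ~ sorted_pair p /\ (tnth G k, tnth G l) = sort_pair p.

Definition sorting_binomial (i j k l : 'I_m) : {mpoly K[m]} :=
  'X_i * 'X_j - 'X_k * 'X_l.

Definition sorting_binomials (f : {mpoly K[m]}) : Prop :=
  exists i j k l, sorting_rule i j k l /\ f = sorting_binomial i j k l.

(* If (u, v) is sorted and u <> v, then (v, u) is unsorted and its binomial    *)
(* y_v y_u - y_u y_v is 0: the condition on leading monomials only concerns    *)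
(* the nonzero binomials.                                                      *)
Definition sorting_order (ord : rel 'X_{1..m}) : Prop :=
  [/\ monomial_order ord,
      groebner_basis ord toric_ideal sorting_binomials
    & forall i j k l, sorting_rule i j k l -> sorting_binomial i j k l != 0 ->
        is_leading_monomial ord (sorting_binomial i j k l) (U_(i) + U_(j))%MM].

End ToricIdeal.

Definition deg_var (K : fieldType) (n : nat) (t : 'I_n) (p : {mpoly K[n]}) : nat :=
  \max_(w <- msupp p) w t.

(* With 0-based indices the condition q <= n - 1 reads q.+1 < n.               *)
Definition l_exchange_property (K : fieldType) (n m : nat)
    (I : {mpoly K[n]} -> Prop) (G : m.-tuple 'X_{1..n}) (ord : rel 'X_{1..m}) :
    Prop :=
  forall a b : 'X_{1..m},
  standard_monomial ord (@toric_ideal K n m G) a ->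
  standard_monomial ord (@toric_ideal K n m G) b ->
  mdeg a = mdeg b ->
  forall q : 'I_n, (q.+1 < n)%N ->
  (forall t : 'I_n, (t < q)%N ->
     deg_var t (toric_map G 'X_[K, a]) = deg_var t (toric_map G 'X_[K, b])) ->
  (deg_var q (toric_map G 'X_[K, a]) < deg_var q (toric_map G 'X_[K, b]))%N ->
  exists (e : 'I_m) (j : 'I_n),
    [/\ (0 < a e)%N, (q < j)%N, (0 < tnth G e j)%N
      & I 'X_[(U_(q) + (tnth G e - U_(j)))%MM]].

(* Main.v *)
Require Import Defs.
From mathcomp Require Import all_boot all_order all_algebra.
From mathcomp Require Import mpoly.

(** For a monomial [w] and [r <= n] let [c_r(w)] be the degree of [w] in the
    first [r] variables.  If [(u, v)] is sorted, then
    [c_r(v) <= c_r(u) <= c_r(v) + 1] for every [r], because the indices of [u]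
    and [v] are the entries of odd and even rank of a weakly increasing sequence
    ([prefix_deg_sorted_pair]).  The generators attached to two distinct variables
    dividing a standard monomial of the toric ideal form a sorted pair in one of
    the two orders ([standard_monomial_sorted]), since otherwise a leading
    monomial of a sorting binomial would divide it.  Hence the factors of a
    standard monomial can be listed as [u_1, ..., u_N] so that, for every [r],
    the sequence [c_r(u_1), ..., c_r(u_N)] is weakly decreasing and takes at most two
    consecutive values ([standard_monomial_listing]); such a sequence is
    determined by its length and its sum ([balanced_eq]).

    Let [u_1, ..., u_N] and [v_1, ..., v_N] be the listings of two standard
    monomials as in the exchange property.  The sums of the [c_r] agree for
    [r < q], hence [u_k] and [v_k] agree in the variables before [x_q], for
    every [k].  As the degree of the second product in [x_q] is larger, some
    [v_k] has a larger exponent at [x_q] than [u_k], and the weakly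
    polymatroidal condition for [v_k] and [u_k] gives the exchange. *)

Set Implicit Arguments.
Unset Strict Implicit.
Unset Printing Implicit Defensive.

Import GRing.Theory.

(** * Balanced sequences of natural numbers *)

(** Weakly decreasing on [0, N), with values that differ by at most one. *)
Definition balanced (N : nat) (x : nat -> nat) : Prop :=
  forall i j, i <= j -> j < N -> x j <= x i <= (x j).+1.

Lemma balanced_lt_sum N x y k : balanced N x -> balanced N y ->
  k < N -> x k < y k -> \sum_(i < N) x i < \sum_(i < N) y i.
Proof.
move=> bx by_ kN lt_k.
have le_xy (i : 'I_N) : x i <= y i.
  case: (leqP i k) => [ik|/ltnW ki].
    have /andP[_ xi] := bx _ _ ik kN; have /andP[yi _] := by_ _ _ ik kN.
    exact: leq_trans xi (leq_trans lt_k yi).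
  have /andP[xi _] := bx _ _ ki (ltn_ord i).
  have /andP[_ yi] := by_ _ _ ki (ltn_ord i).
  by apply: leq_trans xi _; rewrite -ltnS; apply: leq_trans lt_k yi.
rewrite (bigD1 (Ordinal kN)) // [ltnRHS](bigD1 (Ordinal kN)) //=.
by rewrite -addSn leq_add // leq_sum.
Qed.

Lemma balanced_eq N x y : balanced N x -> balanced N y ->
  \sum_(i < N) x i = \sum_(i < N) y i -> forall k, k < N -> x k = y k.
Proof.
move=> bx by_ eq_xy k kN; case: (ltngtP (x k) (y k)) => // lt_k.
  by have := balanced_lt_sum bx by_ kN lt_k; rewrite eq_xy ltnn.
by have := balanced_lt_sum by_ bx kN lt_k; rewrite eq_xy ltnn.
Qed.

(** * Sorted pairs and degrees in the first variables *)

Section PrefixDegree.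

Variable n : nat.
Implicit Types (w u v : 'X_{1..n}) (s : seq 'I_n) (r : nat).

(** The degree of [w] in the first [r] variables. *)
Definition prefix_deg r w : nat := \sum_(i < n | i < r) w i.

Lemma prefix_deg_rec (t : 'I_n) w :
  prefix_deg t.+1 w = prefix_deg t w + w t.
Proof.
rewrite /prefix_deg (bigD1 t) //= addnC; congr (_ + _).
by apply: eq_bigl => i; rewrite ltnS ltn_neqAle andbC.
Qed.

Lemma prefix_deg_mnm_of_indices r s :
  prefix_deg r (mnm_of_indices s) = count (fun i : 'I_n => i < r) s.
Proof.
rewrite /mnm_of_indices; elim: s => [|i s IHs] /=.
  by rewrite big_nil /prefix_deg big1 // => i _; rewrite mnm0E.
rewrite big_cons -IHs /prefix_deg.
rewrite (eq_bigr _ (fun j _ => mnmDE j _ _)) big_split /=; congr (_ + _).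
rewrite big_mkcond (bigD1 i) //= mnm1E eqxx big1 ?addn0; first by case: (i < r).
by move=> j ne_ji; rewrite mnm1E eq_sym (negbTE ne_ji); case: ifP.
Qed.

Lemma pairwise_mnm_indices w :
  pairwise (fun i j : 'I_n => i <= j) (mnm_indices w).
Proof.
rewrite /mnm_indices.
have : pairwise (fun i j : 'I_n => i <= j) (enum 'I_n).
  have := iota_sorted 0 n; rewrite sorted_pairwise; last exact: leq_trans.
  by rewrite -val_enum_ord pairwise_map.
elim: (enum 'I_n) => //= i s IHs /andP[/allP le_i /IHs {}IHs].
rewrite pairwise_cat IHs andbT; apply/andP; split.
  apply/allrelP => x y; rewrite mem_nseq => /andP[_ /eqP->].
  by case/flatten_mapP => j /le_i le_ij; rewrite mem_nseq => /andP[_ /eqP->].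
by elim: (w i) => //= k ->; rewrite andbT all_nseq leqnn orbT.
Qed.

Lemma mem_mnm_indices w i : (i \in mnm_indices w) = (0 < w i).
Proof.
apply/flatten_mapP/idP => [[j _]|w_i].
  by rewrite mem_nseq => /andP[w_j /eqP->].
by exists i; rewrite ?mem_enum // mem_nseq w_i eqxx.
Qed.

Lemma sum_mnm_indices w (F : 'I_n -> nat) :
  \sum_(i <- mnm_indices w) F i = \sum_i w i * F i.
Proof.
rewrite /mnm_indices big_flatten big_map big_enum /=.
by apply: eq_bigr => i _; rewrite big_nseq iter_addn addn0 mulnC.
Qed.

Lemma size_mnm_indices w : size (mnm_indices w) = mdeg w.
Proof.
rewrite -sum1_size sum_mnm_indices mdegE.
by apply: eq_bigr => i _; rewrite muln1.
Qed.

Lemma even_positions_cons i s :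
  even_positions (i :: s) = i :: odd_positions s.
Proof.
rewrite /even_positions /odd_positions /mkseq /= (iotaDl 1 0) -map_comp.
by congr (_ :: mask _ _); apply: eq_map => k /=; rewrite negbK.
Qed.

Lemma odd_positions_cons i s : odd_positions (i :: s) = even_positions s.
Proof.
by rewrite /even_positions /odd_positions /mkseq /= (iotaDl 1 0) -map_comp.
Qed.

(** The entries below [r] form an initial segment of a weakly increasing
    sequence, so the even positions, which start at 0, receive the larger half. *)
Lemma count_positions r s : pairwise (fun i j : 'I_n => i <= j) s ->
  count (fun i : 'I_n => i < r) (even_positions s)
    = uphalf (count (fun i : 'I_n => i < r) s)
  /\ count (fun i : 'I_n => i < r) (odd_positions s)
    = (count (fun i : 'I_n => i < r) s)./2.
Proof.
elim: s => [//|i s IHs]; rewrite even_positions_cons odd_positions_cons /=.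
case/andP=> /allP le_i /IHs[-> ->].
case: ltnP => //= le_ri; suff -> : count (fun i : 'I_n => i < r) s = 0 by [].
apply/eqP; rewrite -leqn0 leqNgt -has_count -all_predC; apply/allP => j /le_i ij.
by rewrite /= -leqNgt (leq_trans le_ri).
Qed.

Lemma prefix_deg_sorted_pair r u v : sorted_pair (u, v) ->
  prefix_deg r v <= prefix_deg r u <= (prefix_deg r v).+1.
Proof.
rewrite /sorted_pair /sort_pair /= => -[u_def v_def].
have [ev od] := count_positions r (pairwise_mnm_indices (u + v)).
rewrite -prefix_deg_mnm_of_indices u_def in ev.
rewrite -prefix_deg_mnm_of_indices v_def in od.
rewrite ev od uphalf_half; case: (odd _) => /=.
  by rewrite leqnSn leqnn.
by rewrite leqnn leqnSn.
Qed.

End PrefixDegree.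

(** * Standard monomials for the sorting order *)

Section StandardMonomials.

Variables (K : fieldType) (n m : nat) (G : m.-tuple 'X_{1..n}).
Implicit Types (a : 'X_{1..m}).

Lemma deg_var_toric_map (t : 'I_n) a :
  deg_var t (toric_map G 'X_[K, a]) = \sum_i a i * tnth G i t.
Proof.
have -> : toric_map G 'X_[K, a] = 'X_[(\sum_i tnth G i *+ a i)%MM].
  rewrite /toric_map comp_mpolyX -mprodXnE.
  by apply: eq_bigr => i _; rewrite tnth_mktuple.
rewrite /deg_var msuppX big_seq1 mnm_sumE.
by apply: eq_bigr => i _; rewrite mulmnE mulnC.
Qed.

Lemma sum_prefix_deg r a (s : seq 'I_m) : perm_eq s (mnm_indices a) ->
  \sum_(i <- s) prefix_deg r (tnth G i)
    = \sum_(t < n | t < r) deg_var t (toric_map G 'X_[K, a]).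
Proof.
move=> perm_s; rewrite (perm_big _ perm_s) sum_mnm_indices.
under eq_bigr => i _ do rewrite /prefix_deg big_distrr /=.
by rewrite exchange_big; apply: eq_bigr => t _; rewrite deg_var_toric_map.
Qed.

Variable ord : rel 'X_{1..m}.
Hypothesis hsort : sortable G.
Hypothesis hord : sorting_order K G ord.

Lemma standard_monomial_sorted a (i j : 'I_m) :
  standard_monomial ord (@toric_ideal K n m G) a ->
  0 < a i -> 0 < a j -> i != j ->
  sorted_pair (tnth G i, tnth G j) \/ sorted_pair (tnth G j, tnth G i).
Proof.
move=> std_a a_i a_j ne_ij; have [_ [binJ _] lead] := hord.
have [/eqP srt|/eqP nsrt] :=
  boolP (sort_pair (tnth G i, tnth G j) == (tnth G i, tnth G j)).
  by left.
have [/tnthP[k k_def] /tnthP[l l_def]] := hsort (mem_tnth i G) (mem_tnth j G).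
have rule : sorting_rule G i j k l.
  by split=> //; rewrite -k_def -l_def -surjective_pairing.
have [/eqP|nz] := boolP (sorting_binomial K i j k l == 0)%R; last first.
  case: std_a; exists [:: ('X_[a - (U_(i) + U_(j))], 'X_[U_(i) + U_(j)])%R].
  split=> [c|].
    rewrite inE => /eqP->; exists (U_(i) + U_(j))%MM => //.
    exists (sorting_binomial K i j k l); last exact: lead.
    by apply: binJ; exists i, j, k, l.
  rewrite big_seq1 /= -mpolyXD submK //; apply/mnm_lepP => x.
  rewrite mnmDE !mnm1E; case: (eqVneq i x) => [<-|_].
    by rewrite eq_sym (negbTE ne_ij).
  by case: (eqVneq j x) => [<-|_].
(* The binomial vanishes only when sorting exchanges the two generators. *)
rewrite /sorting_binomial -!mpolyXD => /subr0_eq.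
move/(congr1 (@msupp _ _)); rewrite !msuppX => /eqP.
rewrite eqseq_cons andbT => /eqP/mnmP eq_at.
right; suff [kj li] : k = j /\ l = i.
  rewrite /sorted_pair {1}/sort_pair /= addmC.
  rewrite -[LHS]/(sort_pair (tnth G i, tnth G j)).
  by rewrite [LHS]surjective_pairing k_def l_def kj li.
have ki : k != i.
  apply/eqP => ki; case: nsrt; rewrite [LHS]surjective_pairing k_def l_def ki.
  congr (_, tnth G _); apply/eqP; have := eq_at j.
  by rewrite !mnmDE !mnm1E ki eqxx (negbTE ne_ij); case: (l == j).
have li : l = i.
  have := eq_at i; rewrite !mnmDE !mnm1E eqxx (negbTE ki).
  by case: (eqVneq l i).
split=> //; apply/eqP; have := eq_at j.
by rewrite !mnmDE !mnm1E li eqxx (negbTE ne_ij); case: (k == j).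
Qed.

(** The order in which the factors of a standard monomial are listed: the
    factor with the larger degrees in all initial sets of variables is first. *)
Definition prefix_deg_ge (i j : 'I_m) : bool :=
  [forall r : 'I_n.+1, prefix_deg r (tnth G j) <= prefix_deg r (tnth G i)].

Lemma standard_monomial_listing a :
  standard_monomial ord (@toric_ideal K n m G) a ->
  exists2 s : seq 'I_m, perm_eq s (mnm_indices a) &
  forall i0 r, r <= n ->
    balanced (size s) (fun k => prefix_deg r (tnth G (nth i0 s k))).
Proof.
move=> std_a; pose s0 := mnm_indices a.
have close i j : i \in s0 -> j \in s0 ->
    (forall r, prefix_deg r (tnth G j) <= prefix_deg r (tnth G i)
                 <= (prefix_deg r (tnth G j)).+1)
    \/ (forall r, prefix_deg r (tnth G i) <= prefix_deg r (tnth G j)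
                 <= (prefix_deg r (tnth G i)).+1).
  rewrite !mem_mnm_indices => a_i a_j; have [->|ne_ij] := eqVneq i j.
    by left=> r; rewrite leqnn leqnSn.
  have [srt|srt] := standard_monomial_sorted std_a a_i a_j ne_ij.
    by left=> r; apply: prefix_deg_sorted_pair.
  by right=> r; apply: prefix_deg_sorted_pair.
have ge_total : {in s0 &, total prefix_deg_ge}.
  move=> i j i_s j_s; have [ge|ge] := close i j i_s j_s; apply/orP; [left|right];
    by apply/forallP => r; case/andP: (ge r).
have ge_trans : transitive prefix_deg_ge.
  move=> j i k /forallP ij /forallP jk; apply/forallP => r.
  exact: leq_trans (jk r) (ij r).
exists (sort prefix_deg_ge s0) => [|i0 r le_rn i j le_ij lt_j].
  by rewrite perm_sort.
have srt : sorted prefix_deg_ge (sort prefix_deg_ge s0).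
  by apply: (sort_sorted_in (P := mem s0)) => //; apply/allP.
have mem_s k : k < size (sort prefix_deg_ge s0) ->
    nth i0 (sort prefix_deg_ge s0) k \in s0.
  by move=> /(mem_nth i0); rewrite mem_sort.
have lt_i := leq_ltn_trans le_ij lt_j.
have ge_ij : prefix_deg r (tnth G (nth i0 (sort prefix_deg_ge s0) j))
          <= prefix_deg r (tnth G (nth i0 (sort prefix_deg_ge s0) i)).
  move: le_ij; rewrite leq_eqVlt => /predU1P[-> //|le_ij].
  have /forallP/(_ (Ordinal (le_rn : r < n.+1))) // :=
    sorted_ltn_nth ge_trans i0 srt _ _ lt_i lt_j le_ij.
rewrite ge_ij; case: (close _ _ (mem_s i lt_i) (mem_s j lt_j)) => /(_ r).
  by case/andP.
by case/andP=> le_ij' _; apply: leq_trans le_ij' (leqnSn _).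
Qed.

End StandardMonomials.

(** * The exchange property *)

Theorem proposition6p1 (K : fieldType) (n m d : nat)
    (I : {mpoly K[n]} -> Prop) (G : m.-tuple 'X_{1..n})
    (hG : minimal_monomial_generators I G)
    (hd : generated_in_degree G d)
    (hwp : weakly_polymatroidal I G)
    (hsort : sortable G)
    (ord : rel 'X_{1..m})
    (hord : sorting_order K G ord) :
  l_exchange_property I G ord.
Proof.
move=> a b std_a std_b eq_deg q _ eq_lt_q lt_q.
have [sa perm_a bal_a] := standard_monomial_listing hsort hord std_a.
have [sb perm_b bal_b] := standard_monomial_listing hsort hord std_b.
have sz_a : size sa = mdeg a by rewrite (perm_size perm_a) size_mnm_indices.
have sz_b : size sb = mdeg a.
  by rewrite (perm_size perm_b) size_mnm_indices eq_deg.
have lt_sum : \sum_(i <- sa) prefix_deg q.+1 (tnth G i)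
            < \sum_(i <- sb) prefix_deg q.+1 (tnth G i).
  rewrite (sum_prefix_deg K _ _ perm_a) (sum_prefix_deg K _ _ perm_b).
  rewrite (bigD1 q) // [ltnRHS](bigD1 q) //= -addSn leq_add //.
  apply: leq_sum => t /andP[lt_tq ne_tq]; rewrite eq_lt_q //.
  by rewrite ltn_neqAle ne_tq -ltnS.
(* A default index for [nth]: the lists are nonempty, as their sums differ. *)
have i0 : 'I_m.
  move: lt_sum; case: (sa) => [|i _ _ //]; case: (sb) => [|i _ _ //].
  by rewrite big_nil.
have eq_pre r : r <= q -> forall k, k < mdeg a ->
    prefix_deg r (tnth G (nth i0 sa k)) = prefix_deg r (tnth G (nth i0 sb k)).
  move=> le_rq; have le_rn : r <= n by rewrite (leq_trans le_rq) // ltnW.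
  move: (bal_a i0 r le_rn) (bal_b i0 r le_rn); rewrite sz_a sz_b => ba bb.
  apply: (balanced_eq ba bb).
  have := sum_prefix_deg K G r perm_a; rewrite (big_nth i0) big_mkord sz_a => ->.
  have := sum_prefix_deg K G r perm_b; rewrite (big_nth i0) big_mkord sz_b => ->.
  by apply: eq_bigr => t lt_tr; rewrite eq_lt_q // (leq_trans lt_tr).
have [k lt_k] : exists k : 'I_(mdeg a),
    prefix_deg q.+1 (tnth G (nth i0 sa k))
      < prefix_deg q.+1 (tnth G (nth i0 sb k)).
  apply/existsP; apply: contraLR lt_sum; rewrite negb_exists -leqNgt => /forallP ge.
  rewrite (big_nth i0) big_mkord [leqRHS](big_nth i0) big_mkord sz_a sz_b.
  by apply: leq_sum => k _; rewrite leqNgt.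
set i := nth i0 sa k in lt_k; set j := nth i0 sb k in lt_k.
have eq_ij (t : 'I_n) : t < q -> tnth G j t = tnth G i t.
  move=> lt_tq; have := eq_pre _ lt_tq k (ltn_ord k).
  rewrite !prefix_deg_rec (eq_pre _ (ltnW lt_tq) k (ltn_ord k)).
  by move/addnI.
have lt_ij : tnth G i q < tnth G j q.
  move: lt_k; rewrite !prefix_deg_rec.
  by rewrite (eq_pre _ (leqnn q) k (ltn_ord k)) ltn_add2l.
have [l [lt_ql l_i I_l]] := hwp _ _ (mem_tnth j G) (mem_tnth i G) q eq_ij lt_ij.
exists i, l; split=> //.
by rewrite -mem_mnm_indices -(perm_mem perm_a) mem_nth // sz_a.
Qed.
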